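(* Let $(G,f)$ be a SED-pair of order $n$, with $G=(V,E)$. Let $E_+ = \{e \in E : f(e)=1\}$, $E_- = \{e\in E : f(e) = -1\}$, and for each vertex $v$ let $s_v = \sum_{e \ni v} f(e)$ (sum over edges containing $v$). Let $V_+ = \{v \in V : s_v \geq 0\}$ and $V_- = \{v\in V : s_v < 0\}$. Suppose that every edge of $E_-$ joins a vertex of $V_+$ with a vertex of $V_-$, and every edge of $E_+$ joins two vertices of $V_+$. Then \[ s[(G,f)] \geq -\frac{1}{54}n^2. \]
   Context: All graphs are finite, simple and undirected. For an edge $e=(u,v)$ of $G$, its closed edge-neighborhood $N[e]$ is the set consisting of $e$ and all edges of $G$ sharing an endpoint with $e$. A function $f: E \to \{+1,-1\}$ is a signed edge domination function of $G=(V,E)$ if $\sum_{e' \in N[e]} f(e') \geq 1$ for every $e \in E$; in this case $(G,f)$ is called a SED-pair of order $|V|$. For such a pair, $s[(G,f)] = \sum_{e\in E} f(e)$. *)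

(* Defs.v *)
From mathcomp Require Import all_boot all_order all_algebra.
Set Implicit Arguments.
Unset Strict Implicit.
Unset Printing Implicit Defensive.
Import Order.TTheory GRing.Theory Num.Theory.
Local Open Scope ring_scope.

Record sgraph (V : finType) := SGraph {
  adj :> rel V;
  adj_sym : symmetric adj;
  adj_irr : irreflexive adj
}.

Section SignedEdgeDomination.
Variables (V : finType) (G : sgraph V).

Definition edges : {set {set V}} :=
  [set e : {set V} | [exists u, exists v, adj G u v && (e == [set u; v])]].

Definition closed_edge_nbhd (e : {set V}) : {set {set V}} :=
  e |: [set e' in edges | e :&: e' != set0].

(* An edge function is a total function on {set V}; only its values on
   edges G are ever constrained or summed. *)
Variable f : {set V} -> int.

Definition SED_pair : Prop :=
  (forall e, e \in edges -> f e = 1 \/ f e = -1) /\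
  (forall e, e \in edges -> 1 <= \sum_(e' in closed_edge_nbhd e) f e').

Definition SED_sum : int := \sum_(e in edges) f e.

Definition Eplus : {set {set V}} := [set e in edges | f e == 1].
Definition Eminus : {set {set V}} := [set e in edges | f e == -1].

Definition vsum (v : V) : int := \sum_(e in edges | v \in e) f e.

Definition Vplus : {set V} := [set v | 0 <= vsum v].
Definition Vminus : {set V} := [set v | vsum v < 0].

End SignedEdgeDomination.

(* Main.v *)
(** Let p_u and q_u be the numbers of positive and negative edges at u, so that
    s_u = p_u - q_u, and put A = {s > 0}, B = {s < 0}, S = sum_A s_u,
    D = sum_A p_u = 2 |E_+|. A vertex v of B has only negative edges, hence
    degree -s_v, and domination along a negative edge uv reads s_u >= -s_v;
    therefore sum_A q_u / s_u <= |B| and sum_A p_u / s_u <= |A| + |B| <= n.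
    Hoelder's inequality over the positive edges turns this into
    D^3 <= S^2 n^2. Finally |E_+| - |E_-| = S - D/2, and
    D^3 - n^2 (D/2 - n^2/54)^2 = (D - n^2/9)^2 (D - n^2/36) gives the bound. *)
Require Import Defs.
From mathcomp Require Import all_boot all_order all_algebra.
From mathcomp Require Import ring lra.
Import Order.TTheory GRing.Theory Num.Theory.
Local Open Scope ring_scope.

(** * Real inequalities: a weighted Hoelder bound and a tangent line *)

(* Hoelder's inequality over pairs for the five functions [s u / N u],
   [s v / N v], [1 / s u], [1 / s v] and [N u * N v], whose product is [1]: it
   gives [D ^+ 5 <= S * S * n * n * D ^+ 2], because [w <= 1] bounds
   [\sum w u v * N u * N v] by [D ^+ 2]. *)
Lemma weighted_degree_holder (R : realFieldType) (T : finType) (A : pred T)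
    (s : T -> R) (w : T -> T -> R) (n : R) :
    (forall u, A u -> 0 < s u) ->
    (forall u v, w u v = w v u) -> (forall u v, 0 <= w u v <= 1) ->
    \sum_(u | A u) \sum_(v | A v) w u v / s u <= n ->
  (\sum_(u | A u) \sum_(v | A v) w u v) ^+ 3
    <= (\sum_(u | A u) s u) ^+ 2 * n ^+ 2.
Proof.
move=> s0 wC w01.
pose N u := \sum_(v | A v) w u v.
have N0 u : 0 <= N u by apply: sumr_ge0 => v _; case/andP: (w01 u v).
rewrite (eq_bigr (fun u => N u / s u)); last by move=> u _; rewrite /N mulr_suml.
set D := \sum_(u | A u) N u; set S := \sum_(u | A u) s u; set H := \sum_(u | _) _.
move=> Hn.
have S0 : 0 <= S by apply: sumr_ge0 => u /s0 /ltW.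
have H0 : 0 <= H by apply: sumr_ge0 => u /s0 /ltW su; rewrite divr_ge0.
have : 0 <= D by exact: sumr_ge0.
rewrite le_eqVlt => /predU1P[<-|D0].
  by rewrite expr0n mulr_ge0 ?sqr_ge0.
have [u Au Nu] : exists2 u, A u & N u != 0.
  apply/exists_inP; apply: contraTT D0; rewrite negb_exists_in => /forall_inP N00.
  by rewrite /D big1 ?ltxx // => u /N00; rewrite negbK => /eqP.
have Sgt0 : 0 < S.
  rewrite /S (bigD1 u) //= ltr_wpDr ?s0 //.
  by apply: sumr_ge0 => v /andP[/s0 /ltW].
have Hgt0 : 0 < H.
  rewrite /H (bigD1 u) //= ltr_wpDr ?divr_gt0 ?s0 // ?lt0r ?Nu ?N0 //.
  by apply: sumr_ge0 => v /andP[/s0 /ltW sv _]; rewrite divr_ge0.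
have n0 : 0 < n by exact: lt_le_trans Hn.
have NS v x : A v -> A x -> w v x != 0 -> 0 < N v.
  move=> Av Ax wvx; rewrite /N (bigD1 x) //= ltr_wpDr //.
    by apply: sumr_ge0 => y _; case/andP: (w01 v y).
  by rewrite lt0r wvx; case/andP: (w01 v x).
rewrite leNgt; apply/negP => big.
(* The five functions are scaled so that the [w]-weighted sum of each over pairs is at most [D].
   Where [w u v != 0] their product is [D ^+ 3 / (S ^+ 2 * n ^+ 2)], which exceeds 1 by [big]. *)
pose X u v (i : 'I_5) : R :=
  nth 0 [:: s u / N u * (D / S); s v / N v * (D / S); (s u)^-1 * (D / n);
            (s v)^-1 * (D / n); N u * N v / D] i.
have sumX u0 v0 : \sum_i X u0 v0 i =
   s u0 / N u0 * (D / S) + s v0 / N v0 * (D / S) + (s u0)^-1 * (D / n) +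
            (s v0)^-1 * (D / n) + N u0 * N v0 / D.
  by rewrite !big_ord_recl big_ord0 /X /= addr0 !addrA.
(* AM-GM: a product above 1 forces the mean of the five factors above 1. *)
have gt5 a b : A a -> A b -> w a b != 0 -> 5 < \sum_i X a b i.
  move=> Aa Ab wab.
  have Na := NS _ _ Aa Ab wab.
  have Nb : 0 < N b by apply: NS Ab Aa _; rewrite wC.
  have sa := s0 _ Aa; have sb := s0 _ Ab.
  have X0 i : i \in 'I_5 -> 0 <= X a b i.
    move=> _; rewrite /X; case: i => [[|[|[|[|[|]]]]] ?] //=;
    by rewrite ?mulr_ge0 ?invr_ge0 ?ltW // ?divr_gt0.
  have := leif_AGM X0; rewrite card_ord => -[AGM _].
  have prodX : \prod_i X a b i = D ^+ 3 / (S ^+ 2 * n ^+ 2).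
    rewrite !big_ord_recl big_ord0 /X /=; field.
    by rewrite ?gt_eqF.
  rewrite ltNge; apply/negP => le5.
  have : 1 < \prod_i X a b i.
    by rewrite prodX ltr_pdivlMr ?mul1r // mulr_gt0 ?exprn_gt0.
  rewrite ltNge => /negP; apply; apply: le_trans AGM _.
  rewrite exprn_ile1 ?divr_ge0 ?sumr_ge0 //.
  by rewrite ler_pdivrMr ?mul1r ?ltr0n.
(* Each of the five weighted sums is at most [D], and the subtracted term is exactly [5 * D]. *)
have le5 : \sum_(a | A a) \sum_(b | A b) w a b * (\sum_i X a b i - 5) <= 0.
  have -> : \sum_(a | A a) \sum_(b | A b) w a b * (\sum_i X a b i - 5)
    = \sum_(a | A a) \sum_(b | A b) w a b * (s a / N a * (D / S))
    + \sum_(a | A a) \sum_(b | A b) w a b * (s b / N b * (D / S))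
    + \sum_(a | A a) \sum_(b | A b) w a b * ((s a)^-1 * (D / n))
    + \sum_(a | A a) \sum_(b | A b) w a b * ((s b)^-1 * (D / n))
    + \sum_(a | A a) \sum_(b | A b) w a b * N a * N b / D
    - \sum_(a | A a) \sum_(b | A b) w a b * 5.
    rewrite -!sumrN -!big_split /=; apply: eq_bigr => a _.
    rewrite -!sumrN -!big_split /=; apply: eq_bigr => b _.
    rewrite sumX; ring.
  have swap (F : T -> R) : \sum_(a | A a) \sum_(b | A b) w a b * F b
     = \sum_(a | A a) N a * F a.
    rewrite exchange_big /=; apply: eq_bigr => a _; rewrite /N mulr_suml.
    by apply: eq_bigr => b _; rewrite wC.
  have same (F : T -> R) : \sum_(a | A a) \sum_(b | A b) w a b * F a
     = \sum_(a | A a) N a * F a.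
    by apply: eq_bigr => a _; rewrite /N mulr_suml.
  have sN : \sum_(a | A a) N a * (s a / N a * (D / S)) <= D.
    have eD : D = \sum_(a | A a) s a * (D / S).
      by rewrite -mulr_suml -/S; field; rewrite gt_eqF.
    rewrite [leRHS]eD; apply: ler_sum => a Aa.
    have [->|Na] := eqVneq (N a) 0.
      by rewrite mul0r mulr_ge0 ?divr_ge0 ?ltW ?s0.
    suff -> : N a * (s a / N a * (D / S)) = s a * (D / S) by [].
    by field; rewrite Na gt_eqF.
  have Ns : \sum_(a | A a) N a * ((s a)^-1 * (D / n)) <= D.
    under eq_bigr do rewrite mulrA.
    by rewrite -mulr_suml -/H mulrCA ler_piMr ?(ltW D0) // ler_pdivrMr ?mul1r.
  have NN : \sum_(a | A a) \sum_(b | A b) w a b * N a * N b / D <= D.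
    have eD : D = \sum_(a | A a) \sum_(b | A b) N a * N b / D.
      under eq_bigr do rewrite -mulr_suml -mulr_sumr -/D mulfK ?gt_eqF //.
      by [].
    rewrite [leRHS]eD; apply: ler_sum => a _; apply: ler_sum => b _.
    rewrite -!mulrA ler_piMl ?mulr_ge0 ?invr_ge0 ?(ltW D0) //.
    by case/andP: (w01 a b).
  have e5 : \sum_(a | A a) \sum_(b | A b) w a b * 5 = 5 * D.
    by under eq_bigr do rewrite -mulr_suml; rewrite -mulr_suml mulrC.
  have /= e1 := same (fun a => s a / N a * (D / S)).
  have /= e2 := swap (fun a => s a / N a * (D / S)).
  have /= e3 := same (fun a => (s a)^-1 * (D / n)).
  have /= e4 := swap (fun a => (s a)^-1 * (D / n)).
  rewrite e1 e2 e3 e4 e5; lra.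
have pos a b : A a -> A b -> 0 <= w a b * (\sum_i X a b i - 5).
  move=> Aa Ab; have [->|wab] := eqVneq (w a b) 0; first by rewrite mul0r.
  rewrite mulr_ge0 ?subr_ge0 ?(ltW (gt5 _ _ Aa Ab wab)) //.
  by case/andP: (w01 a b).
have pos' a : A a -> 0 <= \sum_(b | A b) w a b * (\sum_i X a b i - 5).
  by move=> Aa; apply: sumr_ge0 => b; apply: pos.
have sum0 : \sum_(a | A a) \sum_(b | A b) w a b * (\sum_i X a b i - 5) = 0.
  by apply/eqP; rewrite eq_le le5 sumr_ge0.
(* Nonnegative terms with sum 0 all vanish, so [gt5] leaves only [w u v = 0] for every [v] in [A],
   against [N u != 0]. *)
move/eqP: Nu; apply; rewrite /N big1 // => v Av.
apply/eqP; apply: contraT => wuv.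
have := psumr_eq0P (fun b => pos u b Au) (psumr_eq0P pos' sum0 Au) Av.
by move/eqP; rewrite mulf_eq0 (negPf wuv) subr_eq0 gt_eqF ?gt5.
Qed.

(** For [n > 0] the line [D / 2 - n ^+ 2 / 54] is tangent at [D = n ^+ 2 / 9] to the convex curve
    [D ^ (3/2) / n], which bounds [S] from below; this contact produces the constant 54. *)
Lemma cubic_tangent (R : realFieldType) (S D n : R) :
    0 <= S -> 0 <= n -> D ^+ 3 <= S ^+ 2 * n ^+ 2 ->
  D / 2 - n ^+ 2 / 54 <= S.
Proof.
move=> S0 n0 SD; rewrite leNgt; apply/negP => lt.
have [n00|n1] := eqVneq n 0.
  subst n; move: SD lt; rewrite !expr0n /= mulr0 mul0r subr0 => D3 lt.
  have D0 : 0 < D by lra.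
  by move: D3; rewrite leNgt exprn_gt0.
have npos : 0 < n by rewrite lt0r n1.
have n2 : 0 < n ^+ 2 by rewrite exprn_gt0.
have : S ^+ 2 * n ^+ 2 < (D / 2 - n ^+ 2 / 54) ^+ 2 * n ^+ 2.
  by rewrite ltr_pM2r // ltrXn2r // ?lt_eqF.
(* The last factor is positive: [0 <= S] and [lt] give [D > n ^+ 2 / 27]. *)
have : 0 <= (D - n ^+ 2 / 9) ^+ 2 * (D - n ^+ 2 / 36).
  by rewrite mulr_ge0 ?sqr_ge0 //; lra.
have -> : (D - n ^+ 2 / 9) ^+ 2 * (D - n ^+ 2 / 36)
   = D ^+ 3 - (D / 2 - n ^+ 2 / 54) ^+ 2 * n ^+ 2 by field.
lra.
Qed.

(** * Signed degrees of a pair of relations *)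

(** [P] and [M] stand for positive and negative adjacency, [s] for the signed degree, taken in a
    field so that one can divide by it. The constant is 27 because a sum over vertices counts each
    edge twice. *)
Lemma signed_degree_bound (R : realFieldType) (T : finType) (P M : rel T)
    (s : T -> R) :
    symmetric P -> symmetric M ->
    (forall u, s u = \sum_v (P u v)%:R - \sum_v (M u v)%:R) ->
    (forall u v, P u v -> 0 <= s u) ->
    (forall u v, M u v -> 0 <= s u -> s v < 0) ->
    (forall u v, M u v -> s u < 0 -> 0 <= s v) ->
    (forall u v, M u v -> 0 <= s u + s v) ->
  - (#|T|%:R ^+ 2 / 27) <= \sum_u s u.
Proof.
move=> Psym Msym sE Ppos Mneg Mpos Mdom.
(* A vertex with [s u = 0] carries no edges: a negative one would violate domination, and a positive
   one would need a negative one to balance it. *)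
have MA u v : M u v -> 0 <= s u -> 0 < s u.
  by move=> Muv su; have := Mdom _ _ Muv; have := Mneg _ _ Muv su; lra.
have PA u v : P u v -> 0 < s u.
  move=> Puv; rewrite lt0r (Ppos _ _ Puv) andbT; apply/eqP => su.
  have [w Muw|M0] := pickP (M u).
    by have := MA _ _ Muw; rewrite su lexx ltxx => /(_ isT).
  have := sE u; rewrite su [X in _ - X]big1 => [|w _]; last by rewrite M0.
  rewrite subr0 (bigD1 v) //= Puv => /eqP; rewrite eq_sym gt_eqF //.
  by rewrite ltr_wpDr ?ltr01 ?sumr_ge0.
pose A u := 0 < s u; pose B u := s u < 0.
have sumPA u : \sum_v (P u v)%:R = \sum_(v | A v) (P u v)%:R :> R.
  rewrite [RHS]big_mkcond; apply: eq_bigr => v _; rewrite /A.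
  case: ifPn => // nA; case Puv: (P u v) => //; case/negP: nA.
  by apply: (PA v u); rewrite Psym.
have sumMB u : A u -> \sum_v (M u v)%:R = \sum_(v | B v) (M u v)%:R :> R.
  move=> Au; rewrite [RHS]big_mkcond; apply: eq_bigr => v _; rewrite /B.
  case: ifPn => // nB; case Muv: (M u v) => //; case/negP: nB.
  by apply: Mneg Muv _; apply: ltW.
have sB v : B v -> \sum_(u | A u) (M u v)%:R = - s v.
  move=> Bv; have p0 : \sum_u (P v u)%:R = 0 :> R.
    apply: big1 => u _; case Pvu: (P v u) => //.
    by have := lt_trans (PA _ _ Pvu) Bv; rewrite ltxx.
  rewrite sE p0 sub0r opprK big_mkcond; apply: eq_bigr => u _; rewrite Msym.
  case: ifPn => // nA; case Mvu: (M v u) => //; case/negP: nA.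
  by apply: (MA u v); [rewrite Msym | apply: Mpos Mvu Bv].
set n : R := #|T|%:R.
set S := \sum_(u | A u) s u.
pose D : R := \sum_(u | A u) \sum_(v | A v) (P u v)%:R.
have total : \sum_u s u = 2 * S - D.
  (* Both sides count the negative edges: from their ends in [B], and as [p_u - s_u] from their ends
     in [A]. *)
  have mE : \sum_(v | B v) - s v = D - S.
    rewrite (eq_bigr (fun v => \sum_(u | A u) (M u v)%:R)); last first.
      by move=> v Bv; rewrite sB.
    rewrite exchange_big /D /S -sumrB; apply: eq_bigr => u Au /=.
    rewrite -sumMB // -sumPA sE; ring.
  have -> : \sum_u s u = S + \sum_(v | B v) s v.
    rewrite /S [in RHS]big_mkcond [X in _ + X]big_mkcond -big_split /=.
    by apply: eq_bigr => u _; rewrite /A /B; case: ltgtP; rewrite ?addr0 ?add0r.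
  by move: mE; rewrite sumrN; lra.
have cardE (C : pred T) : #|C|%:R = \sum_(u | C u) 1 :> R.
  by rewrite sumr_const.
have density : \sum_(u | A u) \sum_(v | A v) (P u v)%:R / s u <= n.
  (* Since [p_u = s_u + q_u], each [u] in [A] contributes 1 and each negative edge [uv] adds
     [1 / s u]. *)
  have -> : \sum_(u | A u) \sum_(v | A v) (P u v)%:R / s u
      = #|A|%:R + \sum_(v | B v) \sum_(u | A u) (M u v)%:R / s u.
    rewrite [X in _ + X]exchange_big cardE -big_split; apply: eq_bigr => u Au /=.
    rewrite -!mulr_suml -sumPA -sumMB //.
    have -> : \sum_v (P u v)%:R = s u + \sum_v (M u v)%:R :> R by rewrite sE subrK.
    by rewrite mulrDl divff // gt_eqF.
  have le1 : \sum_(v | B v) \sum_(u | A u) (M u v)%:R / s u <= #|B|%:R.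
    rewrite cardE; apply: ler_sum => v Bv.
    have sv : 0 < - s v by rewrite oppr_gt0.
    (* The 1 is shared equally among the [- s v] edges at [v], and domination bounds [1 / s u] by
       each share. *)
    rewrite [leRHS](_ : 1 = \sum_(u | A u) (M u v)%:R / - s v); last first.
      by rewrite -mulr_suml sB // divff // lt0r_neq0.
    apply: ler_sum => u Au; case Muv: (M u v); last by rewrite !mul0r.
    rewrite !mul1r lef_pV2 ?posrE //.
    by have := Mdom _ _ Muv; lra.
  apply: le_trans (lerD (lexx _) le1) _; rewrite -natrD /n ler_nat.
  rewrite -cardUI [#|predI _ _|]eq_card0 ?addn0 ?max_card // => u.
  by apply/negP => /andP[su su']; have := lt_trans su su'; rewrite ltxx.
have holder : D ^+ 3 <= S ^+ 2 * n ^+ 2.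
  apply: weighted_degree_holder density => // u v; first by rewrite Psym.
  by case: (P u v); rewrite ?lexx ler01.
have S0 : 0 <= S by apply: sumr_ge0 => u /ltW.
have := cubic_tangent _ _ _ _ S0 (ler0n _ _) holder.
by rewrite total -/n; lra.
Qed.

(** * Edges as two-element sets: adjacency, double counting, neighborhood sums *)

Section Handshake.
Variables (V : finType) (G : sgraph V) (f : {set V} -> int).

Lemma edgesP (e : {set V}) :
  reflect (exists u v, adj G u v /\ e = [set u; v]) (e \in edges G).
Proof.
rewrite inE; apply: (iffP existsP) => [[u /existsP[v /andP[uv /eqP ->]]]|].
  by exists u, v.
by case=> u [v [uv ->]]; exists u; apply/existsP; exists v; rewrite uv eqxx.
Qed.

Lemma adj_neq u v : adj G u v -> u != v.
Proof. by apply: contraTneq => ->; rewrite adj_irr. Qed.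

Lemma adj_edge u v : adj G u v = ([set u; v] \in edges G).
Proof.
apply/idP/edgesP => [uv|[x [y [xy /setP e]]]]; first by exists u, v.
have xDy := adj_neq _ _ xy.
have := e x; have := e y; have := e u; have := e v.
rewrite !inE !eqxx ?orbT /= (eq_sym x u) (eq_sym x v) (eq_sym y u) (eq_sym y v).
move=> /esym/orP[] /eqP -> /esym/orP[] /eqP ->;
  rewrite ?eqxx ?(eq_sym y x) ?(negPf xDy) //=.
by rewrite adj_sym.
Qed.

Lemma edge_of_mem (e : {set V}) u v :
  e \in edges G -> u \in e -> v \in e -> u != v -> e = [set u; v].
Proof.
case/edgesP=> x [y [xy ->]]; rewrite !inE.
move=> /orP[] /eqP -> /orP[] /eqP ->; rewrite ?eqxx // => _.
by rewrite setUC.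
Qed.

(** Edges at [u] are parametrised by their other endpoint; this gives the row sums that
    [signed_degree_bound] expects. *)
Lemma vsum_adj u : vsum G f u = \sum_(v | adj G u v) f [set u; v].
Proof.
have inj : {in [pred v | adj G u v] &, injective (fun v => [set u; v])}.
  move=> v w; rewrite !inE => uv uw /setP/(_ v); rewrite !inE eqxx orbT.
  by rewrite eq_sym (negPf (adj_neq _ _ uv)) => /esym/eqP.
rewrite /vsum -(big_imset f inj) /=; apply: eq_bigl => e.
apply/andP/imsetP => [[eE ue]|[v uv ->]]; last first.
  by rewrite -adj_edge !inE eqxx.
case/edgesP: (eE) => x [y [xy e_xy]]; move: ue; rewrite e_xy !inE.
case/orP=> /eqP ->; first by exists y.
by exists x; rewrite ?inE 1?adj_sym // setUC.
Qed.

Lemma sum_vsum : \sum_u vsum G f u = SED_sum G f *+ 2.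
Proof.
rewrite /vsum /SED_sum -sumrMnl.
under eq_bigr do rewrite big_mkcondr.
rewrite exchange_big; apply: eq_bigr => e /edgesP[u [v [uv ->]]].
by rewrite -big_mkcond /= sumr_const cards2 adj_neq.
Qed.

(** The two vertex sums cover all edges meeting [[set u; v]]; only the edge itself contains both
    endpoints and is counted twice. *)
Lemma closed_edge_nbhd_sum u v : adj G u v ->
  \sum_(e in closed_edge_nbhd G [set u; v]) f e
    = vsum G f u + vsum G f v - f [set u; v].
Proof.
move=> uv; have uvE : [set u; v] \in edges G by rewrite -adj_edge.
have nbhdE e : (e \in closed_edge_nbhd G [set u; v])
    = (e \in edges G) && ((u \in e) || (v \in e)).
  rewrite !in_setU in_set1 in_set; case: eqVneq => [->|_] /=.
    by rewrite uvE !inE eqxx.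
  case: (e \in edges G) => //=; apply/set0Pn/orP => [[x]|[ue|ve]].
  - by rewrite !inE => /andP[/orP[] /eqP ->]; [left|right].
  - by exists u; rewrite !inE eqxx.
  - by exists v; rewrite !inE eqxx orbT.
rewrite (eq_bigl _ _ nbhdE) /vsum !big_mkcondr /= -big_split /=.
rewrite [RHS](_ : _ = \sum_(e in edges G)
   ((if u \in e then f e else 0) + (if v \in e then f e else 0)
    - (if e == [set u; v] then f e else 0))); last first.
  rewrite [RHS]big_split /= sumrN; congr (_ - _).
  rewrite -big_mkcondr (big_pred1 [set u; v]) // => e /=.
  by rewrite andbC; case: eqVneq => // ->.
apply: eq_bigr => e eE; case: eqVneq => [->|ne].
  by rewrite !inE !eqxx orbT addrK.
case ue: (u \in e); case ve: (v \in e); rewrite /= ?addr0 ?add0r ?subr0 //.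
by rewrite (edge_of_mem _ _ _ eE ue ve (adj_neq _ _ uv)) eqxx in ne.
Qed.

End Handshake.

(** * The bound for SED-pairs, with [P] and [M] read off from the sign of [f] *)

Theorem theorem3 (n : nat) (V : finType) (G : sgraph V) (f : {set V} -> int)
  (hn : #|V| = n) (hf : SED_pair G f)
  (hminus : forall e : {set V}, e \in Eminus G f ->
     exists u v : V, [/\ u \in Vplus G f, v \in Vminus G f & e = [set u; v]])
  (hplus : forall e : {set V}, e \in Eplus G f ->
     exists u v : V, [/\ u \in Vplus G f, v \in Vplus G f & e = [set u; v]]) :
  - (1 / 54%:R) * n%:R ^+ 2 <= (SED_sum G f)%:~R :> rat.
Proof.
case: hf => f1 fdom.
pose P u v := adj G u v && (f [set u; v] == 1).
pose M u v := adj G u v && (f [set u; v] == -1).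
pose s u : rat := (vsum G f u)%:~R.
(* [hminus] does not say which of [u] and [v] is the nonnegative end, hence the disjunction. *)
have signed u v : M u v -> (0 <= s u) && (s v < 0) || (s u < 0) && (0 <= s v).
  case/andP=> uv fuv; have /hminus[x [y []]] : [set u; v] \in Eminus G f.
    by rewrite inE -adj_edge uv.
  rewrite !inE /s !ler0z !ltrz0 => sx sy /setP e.
  have xDy : x != y by apply: contraTneq sx => ->; rewrite -ltNge.
  have := e u; have := e v; rewrite !inE !eqxx ?orbT.
  move=> /esym/orP[] /eqP ev /esym/orP[] /eqP eu; rewrite eu ev ?sx ?sy ?orbT //.
  - by have := adj_neq _ _ _ _ uv; rewrite eu ev eqxx.
  - by have := adj_neq _ _ _ _ uv; rewrite eu ev eqxx.
have : - (#|V|%:R ^+ 2 / 27) <= \sum_u s u.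
  apply: (signed_degree_bound _ _ P M).
  - by move=> u v; rewrite /P adj_sym setUC.
  - by move=> u v; rewrite /M adj_sym setUC.
  - move=> u; rewrite /s vsum_adj rmorph_sum big_mkcond -sumrB.
    apply: eq_bigr => v _ /=.
    rewrite /P /M; case: ifPn => /= uv; last by rewrite subr0.
    by have [|->|->] := f1 [set u; v]; rewrite -?adj_edge // ?subr0 ?sub0r.
  - move=> u v /andP[uv fuv]; have /hplus[x [y []]] : [set u; v] \in Eplus G f.
      by rewrite inE -adj_edge uv.
    rewrite !inE /s ler0z => sx sy /setP/(_ u); rewrite !inE eqxx.
    by case/esym/orP => /eqP ->.
  - by move=> u v /signed; case: ltgtP => //=; lra.
  - by move=> u v /signed; case: ltgtP => //=; lra.
  - move=> u v /andP[uv /eqP fuv].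
    (* On a negative edge the neighborhood sum is [s_u + s_v + 1], so domination reads
       [0 <= s_u + s_v]. *)
    have := fdom [set u; v]; rewrite -adj_edge closed_edge_nbhd_sum // fuv => /(_ uv).
    rewrite /s -intrD ler0z; lra.
(* The vertex sum is twice [SED_sum], which turns 27 into 54. *)
rewrite /s -rmorph_sum sum_vsum hn rmorphMn /= -mulr_natl; lra.
Qed.
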